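(* Let $\Gamma$ be a discrete group, let $\Sigma=\{F_n\}_{n=1}^\infty$ be a sequence of nonempty finite subsets of $\Gamma$, and let $b\in\Gamma$. Let $\Lambda\subseteq\Gamma$ have positive upper density with respect to $\Sigma$, i.e. $\limsup_{n\to\infty}\frac{|F_n\cap\Lambda|}{|F_n|}>0$. (a) If $b$ fixes $\Sigma$ from the right, i.e. $\lim_{n\to\infty}\frac{|bF_n\,\Delta\, F_n|}{|F_n|}=0$, then for every positive integer $k$ there exist an integer $n>0$ and $a\in\Gamma$ such that $\{b^{jn}a\}_{j=0}^{k-1}\subseteq\Lambda$. (b) If $b$ fixes $\Sigma$ from the left, i.e. $\lim_{n\to\infty}\frac{|F_nb\,\Delta\, F_n|}{|F_n|}=0$, then for every positive integer $k$ there exist an integer $n>0$ and $a\in\Gamma$ such that $\{ab^{jn}\}_{j=0}^{k-1}\subseteq\Lambda$.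
   Context: $\Delta$ denotes symmetric difference of sets and $|\cdot|$ cardinality. *)

(* Defs.v *)
From HB Require Import structures.
From mathcomp Require Import all_boot all_order all_algebra.
From mathcomp Require Import finmap.
From mathcomp Require Import all_classical all_reals all_analysis.
Set Implicit Arguments. Unset Strict Implicit. Unset Printing Implicit Defensive.
Import Order.TTheory GRing.Theory Num.Theory.
Local Open Scope fset_scope.

Definition fsymdiff (K : choiceType) (A B : {fset K}) : {fset K} :=
  (A `\` B) `|` (B `\` A).

Definition ltrans (G : groupType) (b : G) (F : {fset G}) : {fset G} :=
  [fset (b * x)%g | x in F].
Definition rtrans (G : groupType) (b : G) (F : {fset G}) : {fset G} :=
  [fset (x * b)%g | x in F].

Definition dens_ratio (R : realType) (G : groupType) (L : pred G) (F : {fset G}) : R :=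
  ((#|` [fset x in F | L x]|)%:R / (#|` F|)%:R)%R.

Definition sd_ratio (R : realType) (G : groupType) (A F : {fset G}) : R :=
  ((#|` fsymdiff A F|)%:R / (#|` F|)%:R)%R.

(* Main.v *)
Require Import Defs.
From mathcomp Require Import all_boot all_order all_algebra.
From mathcomp Require Import finmap.
From mathcomp Require Import all_classical all_reals all_analysis.
From mathcomp Require Import ring lra zify.
Import Order.TTheory GRing.Theory Num.Theory.
Import numFieldNormedType.Exports.
Set Implicit Arguments.
Unset Strict Implicit.
Local Open Scope classical_set_scope.
Local Open Scope ring_scope.

(** Write T for the translation by b. If F_n is almost T-invariant and L has density
    delta in F_n, then averaging over a in F_n gives a point a for which the words w
    over {0, .., k-1} with T^(w_1 + .. + w_N) a in L have density at least delta/2. A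
    combinatorial line of such words is a progression as required, so the theorem
    follows from the density Hales-Jewett theorem.

    The latter is proved by induction on the alphabet, from k to k+1 letters, along
    the lines of Polymath and of Dodos, Kanellopoulos and Tyros. Let delta be the
    infimum of the densities that force a line, and let A be a line-free set of
    density close to delta. Then all sections of A at a bounded number of coordinates
    have density close to delta. For a word w in these coordinates in which the letter
    k occurs, let w(i) be w with k changed into i. The theorem for k letters gives a
    subspace such that for a positive proportion theta of its points w and of the words
    y in the other coordinates, the k points (w(i), y) with i < k lie in A; it is
    enough to have this on average, so the Graham-Rothschild theorem is not needed.
    As A has no line, (w, y) is then outside A, so A has density at least
    delta (1 + theta), roughly, on the complement of the set of these (w, y). For fixed
    y, this complement is a union of intersections of sets that are insensitive to the
    exchange of a letter i < k with k. By the theorem for k letters, such intersections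
    can be almost partitioned into subspaces of large dimension, so A has density
    larger than delta on one of them, which contradicts the choice of delta. *)

(** * Averages over a list *)

Lemma size_natr_gt0 (R : numDomainType) (T : eqType) (s : seq T) :
  s != [::] -> 0 < (size s)%:R :> R.
Proof. by rewrite ltr0n lt0n size_eq0. Qed.

Lemma sumr_const_seq (V : nmodType) (T : Type) (s : seq T) (x : V) :
  \sum_(i <- s) x = x *+ size s.
Proof. by rewrite big_const_seq count_predT iter_addr_0. Qed.

Definition avg (R : realFieldType) (T : Type) (s : seq T) (f : T -> R) : R :=
  (\sum_(x <- s) f x) / (size s)%:R.

Definition density {R : realFieldType} (T : Type) (s : seq T) (P : pred T) : R :=
  avg s (fun x => (P x)%:R).

Section Average.
Variables (R : realFieldType) (T : eqType).
Implicit Types (s : seq T) (P : pred T) (f g : T -> R) (c : R).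

Lemma le_avg s f g : (forall x, x \in s -> f x <= g x) -> avg s f <= avg s g.
Proof.
move=> fg; rewrite /avg ler_wpM2r ?invr_ge0 ?ler0n //.
by rewrite big_seq [leRHS]big_seq; apply: ler_sum.
Qed.

Lemma eq_avg s f g : (forall x, x \in s -> f x = g x) -> avg s f = avg s g.
Proof. by move=> fg; rewrite /avg; congr (_ / _); apply: eq_big_seq. Qed.

Lemma avgD s f g : avg s (fun x => f x + g x) = avg s f + avg s g.
Proof. by rewrite /avg big_split mulrDl. Qed.

Lemma avgB s f g : avg s (fun x => f x - g x) = avg s f - avg s g.
Proof. by rewrite /avg sumrB mulrBl. Qed.

Lemma avgZ s c f : avg s (fun x => c * f x) = c * avg s f.
Proof. by rewrite /avg -mulr_sumr mulrA. Qed.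

Lemma avg_sum s (J : Type) (r : seq J) (F : J -> T -> R) :
  avg s (fun x => \sum_(i <- r) F i x) = \sum_(i <- r) avg s (F i).
Proof. by rewrite /avg exchange_big mulr_suml. Qed.

Lemma avg_cst s c : s != [::] -> avg s (fun=> c) = c.
Proof.
move=> s0; rewrite /avg sumr_const_seq -[c *+ _]mulr_natr mulfK //.
by rewrite gt_eqF // size_natr_gt0.
Qed.

Lemma avg_ge0 s f : (forall x, x \in s -> 0 <= f x) -> 0 <= avg s f.
Proof. by move=> f0; rewrite /avg divr_ge0 ?ler0n // big_seq; apply: sumr_ge0. Qed.

Lemma avg_le_cst s c f : s != [::] -> (forall x, x \in s -> f x <= c) -> avg s f <= c.
Proof. by move=> s0 fc; rewrite -[leRHS](avg_cst c s0); apply: le_avg. Qed.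

Lemma avg_ge_cst s c f : s != [::] -> (forall x, x \in s -> c <= f x) -> c <= avg s f.
Proof. by move=> s0 cf; rewrite -[leLHS](avg_cst c s0); apply: le_avg. Qed.

Lemma exists_avg_le s f : s != [::] -> exists2 x, x \in s & avg s f <= f x.
Proof.
move=> s0; apply: contrapT => no_x.
have : \sum_(x <- s) f x < \sum_(x <- s) avg s f.
  rewrite big_seq [ltRHS]big_seq; apply: ltr_sum => [|x xs].
    by case: (s) s0 => //= x r _; rewrite mem_head.
  by rewrite ltNge; apply/negP => fx; apply: no_x; exists x.
rewrite sumr_const_seq -[_ *+ _]mulr_natr /avg divfK ?ltxx //.
by rewrite gt_eqF // size_natr_gt0.
Qed.

Lemma density_le1 s P : density s P <= 1 :> R.
Proof.
have [->|s0] := eqVneq s [::]; first by rewrite /density /avg big_nil mul0r.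
by apply: avg_le_cst => // x _; rewrite lern1 leq_b1.
Qed.

Lemma density_ge0 s P : 0 <= density s P :> R.
Proof. exact: avg_ge0. Qed.

Lemma density_gt0_exists s P : 0 < density s P :> R -> exists2 x, x \in s & P x.
Proof.
have [->|s0] := eqVneq s [::]; first by rewrite /density /avg big_nil mul0r ltxx.
have [x xs Px] := exists_avg_le (fun x => (P x)%:R) s0 => density_gt0; exists x => //.
by have := lt_le_trans density_gt0 Px; rewrite ltr0n lt0b.
Qed.

Lemma avg_mul_pred_le s P f : (forall x, x \in s -> f x <= 1) ->
  avg s (fun x => (P x)%:R * f x) <= density s P.
Proof.
by move=> f1; apply: le_avg => x /f1; case: (P x); rewrite /= ?mul1r ?mul0r.
Qed.

Lemma avg_le_density_ge s c f : 0 <= c -> (forall x, x \in s -> f x <= 1) ->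
  avg s f <= density s (fun x => c <= f x) + c.
Proof.
move=> c0 f1; have [->|s0] := eqVneq s [::].
  by rewrite /density /avg !big_nil !mul0r add0r.
rewrite -[X in _ + X](avg_cst c s0) -avgD; apply: le_avg => x /f1 fx1.
by case: (leP c (f x)) => /=; lra.
Qed.

Lemma avg_near_max s f u l x : (forall y, y \in s -> f y <= u) ->
  l <= avg s f -> x \in s -> u - (size s)%:R * (u - l) <= f x.
Proof.
move=> fu lf xs; have s0 : s != [::] by apply/eqP => s0; rewrite s0 in xs.
have n0 := size_natr_gt0 R s0; have : u - f x <= \sum_(y <- s) (u - f y).
  rewrite (big_rem x) //= lerDl big_seq sumr_ge0 // => y /mem_rem /fu.
  by rewrite subr_ge0.
have -> : \sum_(y <- s) (u - f y) = (size s)%:R * (u - avg s f).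
  by rewrite -[u in RHS](avg_cst u s0) -avgB /avg mulrC divfK // gt_eqF.
have : (size s)%:R * (u - avg s f) <= (size s)%:R * (u - l).
  by rewrite ler_pM2l // lerD2l lerN2.
lra.
Qed.

Lemma exchange_avg s (J : Type) (r : seq J) (F : T -> J -> R) :
  avg s (fun x => avg r (F x)) = avg r (fun y => avg s (F^~ y)).
Proof. by rewrite /avg -!mulr_suml exchange_big /= mulrAC. Qed.

Lemma avg_allpairs (I J : Type) (h : I -> J -> T) (r : seq I) (q : seq J) f :
  avg [seq h x y | x <- r, y <- q] f = avg r (fun x => avg q (fun y => f (h x y))).
Proof.
by rewrite /avg big_allpairs_dep size_allpairs natrM invfM -mulr_suml mulrA mulrAC.
Qed.

Lemma avg_image (J : eqType) s (r : seq J) (h : J -> T) f :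
  uniq s -> uniq r -> r != [::] -> {in r &, injective h} -> {subset map h r <= s} ->
  avg s (fun x => (x \in map h r)%:R * f x)
  = (size r)%:R / (size s)%:R * avg r (fun y => f (h y)).
Proof.
move=> us ur r0 h_inj h_sub; have n0 := size_natr_gt0 R r0.
rewrite /avg [RHS]mulrC mulrA divfK ?gt_eqF //; congr (_ / _).
rewrite -(big_map h xpredT f) /=.
under eq_bigr => x _ do rewrite mulr_natl mulrb.
rewrite -big_mkcond -big_filter; apply: perm_big; apply: uniq_perm.
- by rewrite filter_uniq.
- by rewrite map_inj_in_uniq.
- by move=> x; rewrite mem_filter andb_idr // => /h_sub.
Qed.

End Average.

Lemma density_pigeonhole (R : realFieldType) (T J : eqType) (s : seq T) (r : seq J)
    (P : pred T) (Q : J -> pred T) (c : R) :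
  0 < c -> c <= density s P ->
  (forall x, x \in s -> P x -> exists2 i, i \in r & Q i x) ->
  exists2 i, i \in r & c / (size r)%:R <= density s (Q i).
Proof.
move=> c0 c_le covered.
have c_sum : c <= \sum_(i <- r) density s (Q i).
  apply: le_trans c_le _; rewrite -avg_sum; apply: le_avg => x xs.
  have [Px|_] := boolP (P x); last by apply: sumr_ge0 => i _; rewrite ler0n.
  have [i ir Qix] := covered x xs Px.
  by rewrite (big_rem i) //= Qix lerDl; apply: sumr_ge0 => ? _; rewrite ler0n.
have r0 : r != [::] by apply: contraTneq c_sum => ->; rewrite big_nil -ltNge.
have [i ir le_i] := exists_avg_le (fun i => density s (Q i) : R) r0.
by exists i => //; apply: le_trans _ le_i; rewrite /avg ler_pM2r ?invr_gt0 ?size_natr_gt0.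
Qed.

Lemma iota_neq0 m n : (0 < n)%N -> iota m n != [::].
Proof. by case: n. Qed.

Lemma avg_iotaS (R : realFieldType) k (f : nat -> R) : (0 < k)%N ->
  avg (iota 0 k.+1) f = (k.+1%:R)^-1 * f k + (1 - (k.+1%:R)^-1) * avg (iota 0 k) f.
Proof.
move=> k0; rewrite /avg !size_iota -addn1 iotaD big_cat big_seq1 /= add0n.
have k_neq0 : k%:R != 0 :> R by rewrite pnatr_eq0 -lt0n.
have kS_neq0 : k%:R + 1 != 0 :> R by rewrite natr1 pnatr_eq0.
by rewrite natrD; field; rewrite k_neq0.
Qed.

(** * Words *)

Section Words.
Variable T : eqType.
Implicit Types (s : seq T) (n : nat).

Fixpoint words s n : seq (seq T) :=
  if n is n'.+1 then [seq a :: w | a <- s, w <- words s n'] else [:: [::]].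

Lemma wordsP s n w : reflect (size w = n /\ {subset w <= s}) (w \in words s n).
Proof.
elim: n w => [|n IH] [|a w] /=.
- by rewrite inE; left.
- by right=> -[].
- by apply: (iffP allpairsP) => [[[b v] []]|[]].
apply: (iffP allpairsP) => [[[b v] /= [bs /IH[<- vs] [-> ->]]]|[[sw] aws]].
  by split=> // c; rewrite inE => /predU1P[->|/vs].
exists (a, w); split=> //=; first by apply: aws; rewrite mem_head.
by apply/IH; split=> // c cw; apply: aws; rewrite inE cw orbT.
Qed.

Lemma words_uniq s n : uniq s -> uniq (words s n).
Proof.
move=> us; elim: n => //= n IH.
by apply: allpairs_uniq => // -[a v] [b w] _ _ /= [-> ->].
Qed.

Lemma size_words s n : size (words s n) = (size s ^ n)%N.
Proof. by elim: n => //= n IH; rewrite size_allpairs IH expnS. Qed.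

Lemma words_neq0 s n : s != [::] -> words s n != [::].
Proof. by rewrite -!size_eq0 size_words expn_eq0 => /negPf ->. Qed.

Lemma words_cons s n a w : a \in s -> w \in words s n -> a :: w \in words s n.+1.
Proof. exact: allpairs_f. Qed.

Lemma words_consP s n w :
  w \in words s n.+1 -> exists a v, [/\ w = a :: v, a \in s & v \in words s n].
Proof. by case/allpairsP => -[a v] /= [as_ vs ->]; exists a, v. Qed.

Lemma words1 s : words s 1 = [seq [:: a] | a <- s].
Proof. by rewrite /= allpairs1r. Qed.

Lemma words_cat s m n x y :
  x \in words s m -> y \in words s n -> x ++ y \in words s (m + n).
Proof.
move=> /wordsP[<- xs] /wordsP[<- ys]; apply/wordsP; rewrite size_cat; split=> // a.
by rewrite mem_cat => /orP[/xs|/ys].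
Qed.

Variable R : realFieldType.
Implicit Type f : seq T -> R.

Lemma avg_words0 s f : avg (words s 0) f = f [::].
Proof. by rewrite /avg big_seq1 divr1. Qed.

Lemma avg_wordsS s n f :
  avg (words s n.+1) f = avg s (fun a => avg (words s n) (fun w => f (a :: w))).
Proof. exact: avg_allpairs. Qed.

Lemma avg_words_cat s m n f :
  avg (words s (m + n)) f =
    avg (words s m) (fun x => avg (words s n) (fun y => f (x ++ y))).
Proof.
elim: m f => [|m IH] f; first by rewrite avg_words0.
by rewrite addSn !avg_wordsS; apply: eq_avg => a _; rewrite IH.
Qed.

End Words.

Notation cube k n := (words (iota 0 k) n).

Lemma cubeP k n w :
  reflect (size w = n /\ {in w, forall a, (a < k)%N}) (w \in cube k n).
Proof.
by apply: (iffP (wordsP _ _ _)) => -[sw kw]; split=> // a /kw; rewrite mem_iota.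
Qed.

Lemma cube_size k n w : w \in cube k n -> size w = n.
Proof. by case/cubeP. Qed.

Lemma size_cube k n : size (cube k n) = (k ^ n)%N.
Proof. by rewrite size_words size_iota. Qed.

Lemma cube_uniq k n : uniq (cube k n).
Proof. exact: words_uniq (iota_uniq 0 k). Qed.

Lemma cube_neq0 k n : (0 < k)%N -> cube k n != [::].
Proof. by move=> k0; rewrite words_neq0 ?iota_neq0. Qed.

Lemma cube_nth k n w i : w \in cube k n -> (i < n)%N -> (nth 0%N w i < k)%N.
Proof. by case/cubeP=> <- kw i_n; apply: kw; rewrite mem_nth. Qed.

Lemma sub_cube k l n : (k <= l)%N -> {subset cube k n <= cube l n}.
Proof.
move=> kl w /cubeP[sw kw]; apply/cubeP; split=> // a /kw ak.
exact: leq_trans ak kl.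
Qed.

Lemma cube_cons k n a w : (a < k)%N -> w \in cube k n -> a :: w \in cube k n.+1.
Proof. by move=> ak; apply: words_cons; rewrite mem_iota. Qed.

(** * Combinatorial subspaces *)

(* A combinatorial subspace of dimension d of the cube k n is given by a word over
   k + d letters, where the letter k + i stands for the i-th variable and each
   variable occurs. Filling the variables with letters < k gives the points of the
   subspace; filling them with a word that has variables itself gives a subspace of
   the subspace. A word over k.+1 letters in which k occurs is thus a line. *)
Definition fill (k : nat) (U z : seq nat) : seq nat :=
  [seq (if (c < k)%N then c else nth 0%N z (c - k)) | c <- U].

Definition subspace (k d n : nat) (U : seq nat) : bool :=
  (U \in cube (k + d) n) && all (mem U) (iota k d).

Definition relabel (k j : nat) (w : seq nat) : seq nat := fill k w [:: j].

Definition shift (k d : nat) (V : seq nat) : seq nat :=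
  [seq (if (c < k)%N then c else (d + c)%N) | c <- V].

Lemma subspaceP k d n U :
  reflect (U \in cube (k + d) n /\ forall i, (i < d)%N -> (k + i)%N \in U)
          (subspace k d n U).
Proof.
apply: (iffP andP) => -[kU varU]; split=> //.
  by move=> i id; apply: (allP varU); rewrite mem_iota; lia.
apply/allP=> c; rewrite mem_iota => /andP[kc ck].
by rewrite -(subnKC kc); apply: varU; lia.
Qed.

Lemma subspace_cube k d n U : subspace k d n U -> U \in cube (k + d) n.
Proof. by case/andP. Qed.

Lemma subspace_size k d n U : subspace k d n U -> size U = n.
Proof. by move/subspace_cube/cube_size. Qed.

Lemma fill_cat k U V z : fill k (U ++ V) z = fill k U z ++ fill k V z.
Proof. exact: map_cat. Qed.

Lemma size_fill k U z : size (fill k U z) = size U.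
Proof. exact: size_map. Qed.

Lemma fill_id k n w z : w \in cube k n -> fill k w z = w.
Proof.
by move=> /cubeP[_ kw]; rewrite /fill -[RHS]map_id; apply/eq_in_map => c /kw ->.
Qed.

Lemma fill_in_cube k l d n U z : (k <= l)%N ->
  U \in cube (k + d) n -> z \in cube l d -> fill k U z \in cube l n.
Proof.
move=> kl /cubeP[<- kU] lz; apply/cubeP; rewrite size_fill; split=> // a.
move=> /mapP[c /kU ck ->]; case: (ltnP c k) => kc; first exact: leq_trans kc kl.
by apply: (cube_nth lz); lia.
Qed.

Lemma fill_fill k l d n U V z : (k <= l)%N -> U \in cube (k + d) n -> size V = d ->
  fill l (fill k U V) z = fill k U (fill l V z).
Proof.
move=> kl /cubeP[_ kU] sV; rewrite /fill -map_comp; apply/eq_in_map => c /kU ck /=.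
case: (ltnP c k) => kc; first by rewrite (leq_trans kc kl).
by rewrite (nth_map 0%N) // sV; lia.
Qed.

Lemma mem_fill k d n U z c :
  subspace k d n U -> size z = d -> c \in z -> c \in fill k U z.
Proof.
move=> /subspaceP[kU varU] sz cz.
have id : (index c z < d)%N by rewrite -sz index_mem.
apply/mapP; exists (k + index c z)%N; first exact: varU.
by rewrite ltnNge leq_addr /= addKn nth_index.
Qed.

Lemma fill_inj k d n U z z' : subspace k d n U -> size z = d -> size z' = d ->
  fill k U z = fill k U z' -> z = z'.
Proof.
move=> /subspaceP[_ varU] sz sz' /eq_in_map eqU.
apply: (@eq_from_nth _ 0%N); first by rewrite sz'.
by move=> i; rewrite sz => /varU/eqU; rewrite ltnNge leq_addr /= addKn.
Qed.

Lemma subspace_comp k d e n U V :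
  subspace k d n U -> subspace k e d V -> subspace k e n (fill k U V).
Proof.
move=> subU /subspaceP[kV varV]; apply/subspaceP; split.
  by apply: fill_in_cube (subspace_cube subU) kV; lia.
by move=> i id; apply: (mem_fill subU); rewrite ?(cube_size kV) ?varV.
Qed.

Lemma subspace_catl k d m n x U :
  x \in cube k m -> subspace k d n U -> subspace k d (m + n) (x ++ U).
Proof.
move=> kx /subspaceP[kU varU]; apply/subspaceP; split.
  by apply: words_cat kU; apply: sub_cube kx; lia.
by move=> i /varU iU; rewrite mem_cat iU orbT.
Qed.

Lemma subspace_catr k d m n y U :
  y \in cube k n -> subspace k d m U -> subspace k d (m + n) (U ++ y).
Proof.
move=> ky /subspaceP[kU varU]; apply/subspaceP; split.
  by apply: words_cat kU _; apply: sub_cube ky; lia.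
by move=> i /varU iU; rewrite mem_cat iU.
Qed.

Lemma subspace_vars k d : subspace k d d (iota k d).
Proof.
apply/subspaceP; split; last by move=> i id; rewrite mem_iota; lia.
by apply/cubeP; rewrite size_iota; split=> // a; rewrite mem_iota; lia.
Qed.

Lemma fill_vars k d z : size z = d -> fill k (iota k d) z = z.
Proof.
move=> <-; apply: (@eq_from_nth _ 0%N); rewrite size_fill size_iota // => i iz.
by rewrite (nth_map 0%N) ?size_iota // nth_iota // ltnNge leq_addr /= addKn.
Qed.

Lemma shift_in_cube k d e n V :
  V \in cube (k + e) n -> shift k d V \in cube (k + (d + e)) n.
Proof.
move=> /cubeP[sV kV]; apply/cubeP; rewrite size_map; split=> // a.
by move=> /mapP[c /kV]; case: (ltnP c k) => ? ? ->; lia.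
Qed.

Lemma shift_var k d V i : (k + i)%N \in V -> (k + (d + i))%N \in shift k d V.
Proof.
by move=> iV; apply/mapP; exists (k + i)%N; rewrite // ltnNge leq_addr /= addnCA.
Qed.

Lemma fill_shift_widen k d V z : fill (d + k) (shift k d V) z = fill k V z.
Proof.
rewrite /fill -map_comp; apply: eq_map => c /=; case: (ltnP c k) => kc.
  by rewrite ltn_addl.
by rewrite ltn_add2l ltnNge kc /= subnDl.
Qed.

Lemma subspace_widen k d e n V :
  subspace k e n V -> subspace (d + k) e n (shift k d V).
Proof.
move=> /subspaceP[/(shift_in_cube d) kV varV]; apply/subspaceP; rewrite -addnA addnCA.
by split=> // i /varV/(shift_var d); rewrite -addnA addnCA.
Qed.

Lemma subspace_cat k d e m n U V : subspace k d m U -> subspace k e n V ->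
  subspace k (d + e) (m + n) (U ++ shift k d V).
Proof.
move=> /subspaceP[kU varU] /subspaceP[/(shift_in_cube d) kV varV].
apply/subspaceP; split.
  by apply: words_cat kV; apply: sub_cube kU; lia.
move=> i ide; rewrite mem_cat; case: (ltnP i d) => [/varU -> //|di].
have /varV/(shift_var d) : (i - d < e)%N by lia.
by rewrite subnKC // => ->; rewrite orbT.
Qed.

Lemma fill_cat_shift k d m U V x y : U \in cube (k + d) m -> size x = d ->
  fill k (U ++ shift k d V) (x ++ y) = fill k U x ++ fill k V y.
Proof.
move=> /cubeP[_ kU] sx; rewrite fill_cat; congr (_ ++ _).
  apply/eq_in_map => c /kU ck; case: (ltnP c k) => // kc.
  by rewrite nth_cat sx ifT //; lia.
rewrite /fill -map_comp; apply: eq_map => c /=; case: (ltnP c k) => kc.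
  by rewrite kc.
rewrite ltnNge (leq_trans kc (leq_addl _ _)) /= nth_cat sx -addnBA //.
by rewrite ltnNge leq_addr /= addKn.
Qed.

Section Relabel.
Variables (k j : nat).
Hypothesis jk : (j < k)%N.

Lemma relabel_in_cube n w : w \in cube k.+1 n -> relabel k j w \in cube k n.
Proof. by move=> kw; apply: (@fill_in_cube k k 1); rewrite ?addn1 ?cube_cons. Qed.

Lemma relabel_idem n w :
  w \in cube k.+1 n -> relabel k j (relabel k j w) = relabel k j w.
Proof. by move=> /relabel_in_cube kw; rewrite {1}/relabel (fill_id _ kw). Qed.

Lemma relabel_fill d n U z : U \in cube (k.+1 + d) n -> z \in cube k.+1 d ->
  relabel k j (fill k.+1 U (relabel k j z)) = relabel k j (fill k.+1 U z).
Proof.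
move=> /cubeP[_ kU] kz; rewrite /relabel /fill -!map_comp; apply/eq_in_map => c /kU ck /=.
case: (ltnP c k.+1) => // kc.
have cz : (c - k.+1 < d)%N by lia.
rewrite (nth_map 0%N); last by rewrite (cube_size kz).
case: (ltnP (nth 0%N z (c - k.+1)) k) => [->//|kn].
have := cube_nth kz cz; rewrite ltnS => nk.
by rewrite (_ : nth _ _ _ - k = 0)%N ?jk //; lia.
Qed.

End Relabel.

Lemma relabel_self k n w : w \in cube k.+1 n -> relabel k k w = w.
Proof.
move=> /cubeP[_ kw]; rewrite /relabel /fill -[RHS]map_id; apply/eq_in_map => c /kw ck.
case: (ltnP c k) => // kc; have -> : c = k by lia.
by rewrite subnn.
Qed.

(** * Predicates on cubes *)

Section InterBelow.
Variable T : Type.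
Implicit Type D : nat -> pred T.

Definition inter_below D (k : nat) : pred T := fun x => all (D^~ x) (iota 0 k).

Lemma inter_belowS D k x : inter_below D k.+1 x = inter_below D k x && D k x.
Proof. by rewrite /inter_below -addn1 iotaD all_cat /= andbT. Qed.

Lemma inter_below_first_failure D k i x : (i < k)%N ->
  inter_below (fun j y => if (j < i)%N then D j y else (j == i) ==> ~~ D j y) k x
  = inter_below D i x && ~~ D i x.
Proof.
move=> ik; apply/allP/andP => [fails|[/allP holds Dix] j _].
  split; last by have := fails i; rewrite mem_iota ltnn eqxx => /(_ ik).
  apply/allP => j; rewrite mem_iota add0n => /andP[_ ji].
  by have := fails j; rewrite mem_iota ji => /(_ (ltn_trans ji ik)).
case: (ltnP j i) => ji; first by apply: holds; rewrite mem_iota.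
by apply/implyP => /eqP ->.
Qed.

Lemma natr_not_inter_below (R : pzRingType) D k x :
  (~~ inter_below D k x)%:R
  = \sum_(i <- iota 0 k) (inter_below D i x && ~~ D i x)%:R :> R.
Proof.
elim: k => [|k IH]; first by rewrite big_nil.
rewrite inter_belowS -addn1 iotaD big_cat -IH big_seq1.
by case: (inter_below _ _ _); case: (D k x); rewrite /= ?addr0 ?add0r.
Qed.

End InterBelow.

Definition lies_in (k d : nat) (U : seq nat) (A : pred (seq nat)) : bool :=
  all (fun z => A (fill k U z)) (cube k d).

Definition contains_subspace (k d n : nat) (A : pred (seq nat)) : Prop :=
  exists2 U, subspace k d n U & lies_in k d U A.

Lemma lies_in_line k U A :
  lies_in k 1 U A = inter_below (fun i w => A (relabel k i w)) k U.
Proof. by rewrite /lies_in words1 all_map. Qed.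

Lemma lies_in_comp k l d e n U V A : (k <= l)%N -> U \in cube (k + d) n -> size V = d ->
  lies_in l e (fill k U V) A = lies_in l e V (fun z => A (fill k U z)).
Proof. by move=> kl kU sV; apply: eq_all => z; rewrite (fill_fill _ kl kU). Qed.

Lemma contains_subspace_comp k d e n U A : subspace k d n U ->
  contains_subspace k e d (fun z => A (fill k U z)) -> contains_subspace k e n A.
Proof.
move=> subU [V subV VA]; exists (fill k U V); first exact: subspace_comp subV.
by rewrite (lies_in_comp _ _ _ (subspace_cube subU)) // (subspace_size subV).
Qed.

Lemma contains_subspace_catr k d m n y A : y \in cube k n ->
  contains_subspace k d m (fun x => A (x ++ y)) -> contains_subspace k d (m + n) A.
Proof.
move=> ky [U subU UA]; exists (U ++ y); first exact: subspace_catr.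
by apply/allP => z /(allP UA); rewrite fill_cat (fill_id _ ky).
Qed.

Lemma contains_line_top k n w A : w \in cube k.+1 n -> k \in w ->
  lies_in k 1 w A -> A w -> contains_subspace k.+1 1 n A.
Proof.
rewrite lies_in_line => kw w_k /allP wA Aw.
have kw1 : w \in cube (k + 1) n by rewrite addn1.
exists (relabel k k.+1 w).
  apply/subspaceP; split.
    by rewrite addn1; apply: (fill_in_cube _ kw1); [lia|apply: cube_cons].
  case=> // _; rewrite addn0; apply/mapP; exists k => //.
  by rewrite ltnn subnn.
rewrite lies_in_line; apply/allP => e; rewrite mem_iota ltnS => /andP[_ ek].
have -> : relabel k.+1 e (relabel k k.+1 w) = relabel k e w.
  by rewrite /relabel (fill_fill _ _ kw1) //= ltnn subnn.
have [->|e_neq_k] := eqVneq e k; first by rewrite (relabel_self kw).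
by apply: wA; rewrite mem_iota ltn_neqAle e_neq_k.
Qed.

Definition insensitive (k j n : nat) (E : pred (seq nat)) : Prop :=
  {in cube k.+1 n, forall w, E w = E (relabel k j w)}.

Section Insensitive.
Variables (k j : nat).
Hypothesis jk : (j < k)%N.
Implicit Types E : pred (seq nat).

Lemma relabel_in_cubeS n w : w \in cube k.+1 n -> relabel k j w \in cube k.+1 n.
Proof. by move/(relabel_in_cube jk); apply: sub_cube. Qed.

Lemma insensitive_catl m n E x : insensitive k j (m + n) E -> x \in cube k.+1 m ->
  insensitive k j n (fun y => E (x ++ y)).
Proof.
move=> insE kx y ky; rewrite insE ?words_cat // [RHS]insE ?words_cat ?relabel_in_cubeS //.
by rewrite /relabel !fill_cat -!/(relabel _ _ _) (relabel_idem jk ky).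
Qed.

Lemma insensitive_catr m n E y : insensitive k j (m + n) E -> y \in cube k.+1 n ->
  insensitive k j m (fun x => E (x ++ y)).
Proof.
move=> insE ky x kx; rewrite insE ?words_cat // [RHS]insE ?words_cat ?relabel_in_cubeS //.
by rewrite /relabel !fill_cat -!/(relabel _ _ _) (relabel_idem jk kx).
Qed.

Lemma insensitive_fill d n E U : insensitive k j n E -> U \in cube (k.+1 + d) n ->
  insensitive k j d (fun z => E (fill k.+1 U z)).
Proof.
move=> insE kU z kz.
rewrite insE ?(fill_in_cube _ kU) // [RHS]insE ?(fill_in_cube _ kU) ?relabel_in_cubeS //.
by rewrite (relabel_fill jk kU kz).
Qed.

Lemma insensitive_relabel d n E U : U \in cube (k.+1 + d) n ->
  insensitive k j d (fun z => E (relabel k j (fill k.+1 U z))).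
Proof. by move=> kU z kz; rewrite (relabel_fill jk kU kz). Qed.

End Insensitive.

(** * Density *)

Definition forces (R : realFieldType) (k d n : nat) (delta : R) : Prop :=
  forall A, delta <= density (cube k n) A -> contains_subspace k d n A.

Definition dhj (R : realFieldType) (k : nat) : Prop :=
  forall d (delta : R), 0 < delta -> exists n, forces k d n delta.

Definition subspace_avg_le (R : realFieldType) (k d n : nat) (f : seq nat -> R) (c : R) :=
  forall U, subspace k d n U -> avg (cube k d) (fun z => f (fill k U z)) <= c.

Section Density.
Variable R : realFieldType.
Implicit Types (A E : pred (seq nat)) (f : seq nat -> R).

Lemma density_cat k m n A :
  density (cube k (m + n)) A =
    avg (cube k n) (fun y => density (cube k m) (fun x => A (x ++ y))) :> R.
Proof. by rewrite /density avg_words_cat exchange_avg. Qed.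

Lemma common_subspace (T : eqType) (t : seq T) k d m (B : T -> pred (seq nat)) (a b : R) :
  (0 < k)%N -> 0 <= a -> 0 < b ->
  {in t, forall y, a <= density (cube k m) (B y) -> contains_subspace k d m (B y)} ->
  a + b <= avg t (fun y => density (cube k m) (B y)) ->
  exists2 U, subspace k d m U &
    b / ((k + d) ^ m)%:R <= density t (fun y => lies_in k d U (B y)).
Proof.
move=> k0 a0 b0 dense ab.
have b_dense : b <= density t (fun y => a <= density (cube k m) (B y)).
  have := avg_le_density_ge a0 (fun y (_ : y \in t) => density_le1 R (cube k m) (B y)).
  by lra.
have [|U _] := density_pigeonhole (r := cube (k + d) m)
  (Q := fun U y => subspace k d m U && lies_in k d U (B y)) b0 b_dense.
  move=> y /dense By_sub /By_sub[U subU UB].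
  by exists U; [exact: subspace_cube subU|rewrite subU].
rewrite size_cube => avgU.
have kd0 : 0 < ((k + d) ^ m)%:R :> R by rewrite ltr0n expn_gt0 addn_gt0 k0.
have [y _ /andP[subU _]] := density_gt0_exists (lt_le_trans (divr_gt0 b0 kd0) avgU).
by exists U => //; move: avgU; rewrite subU.
Qed.

Lemma subspace_avg_le_catl k d m n f c x : x \in cube k m ->
  subspace_avg_le k d (m + n) f c -> subspace_avg_le k d n (fun y => f (x ++ y)) c.
Proof.
move=> kx fc U subU; have := fc _ (subspace_catl kx subU); congr (_ <= _).
by apply: eq_avg => z _; rewrite fill_cat (fill_id _ kx).
Qed.

Lemma subspace_avg_le_catr k d m n f c y : y \in cube k n ->
  subspace_avg_le k d (m + n) f c -> subspace_avg_le k d m (fun x => f (x ++ y)) c.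
Proof.
move=> ky fc U subU; have := fc _ (subspace_catr ky subU); congr (_ <= _).
by apply: eq_avg => z _; rewrite fill_cat (fill_id _ ky).
Qed.

Lemma subspace_avg_le_fill k d e n f c U : subspace k e n U ->
  subspace_avg_le k d n f c -> subspace_avg_le k d e (fun z => f (fill k U z)) c.
Proof.
move=> subU fc V subV; have := fc _ (subspace_comp subU subV); congr (_ <= _).
apply: eq_avg => z _; rewrite (fill_fill _ _ (subspace_cube subU)) //.
exact: subspace_size subV.
Qed.

Lemma avg_le_subspace_avg k d f c : subspace_avg_le k d d f c -> avg (cube k d) f <= c.
Proof.
move/(_ _ (subspace_vars k d)); congr (_ <= _); apply: eq_avg => z kz.
by rewrite fill_vars // (cube_size kz).
Qed.

Lemma forces_density_le k d e n (delta : R) A :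
  forces k d e delta -> ~ contains_subspace k d n A ->
  subspace_avg_le k e n (fun w => (A w)%:R) delta.
Proof.
move=> delta_forces A_free U subU; rewrite leNgt; apply/negP => /ltW AU; apply: A_free.
exact: contains_subspace_comp subU (delta_forces (fun z => A (fill k U z)) AU).
Qed.

(* By the pigeonhole principle, a dense set of sections contains a common line. *)
Lemma dhj_of_lines k : (0 < k)%N ->
  (forall delta : R, 0 < delta -> exists n, forces k 1 n delta) -> dhj R k.
Proof.
move=> k0 lines; elim=> [|d IH] delta delta0.
  exists 0%N => A /(lt_le_trans delta0) /density_gt0_exists[w kw Aw].
  exists w; first by rewrite /subspace addn0 kw.
  by apply/allP => z _; rewrite (fill_id _ kw).
have delta2 : 0 < delta / 2 by lra.
have [m line_m] := lines _ delta2.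
have km0 : 0 < ((k + 1) ^ m)%:R :> R by rewrite ltr0n expn_gt0 addn1.
have [n sub_n] := IH _ (divr_gt0 delta2 km0).
exists (m + n)%N => A; rewrite density_cat => A_dense.
have [L lineL L_dense] : exists2 L, subspace k 1 m L & delta / 2 / ((k + 1) ^ m)%:R <=
    density (cube k n) (fun y => lies_in k 1 L (fun x => A (x ++ y))).
  apply: (common_subspace k0 (ltW delta2) delta2) => [y _|]; first exact: line_m.
  by move: A_dense; congr (_ <= _); lra.
have [V subV VA] := sub_n _ L_dense.
exists (L ++ shift k 1 V); first exact: subspace_cat lineL subV.
apply/allP => z /words_consP[a [y [-> ak /(allP VA) LA]]].
rewrite -cat1s (fill_cat_shift _ _ (subspace_cube lineL)) //.
by apply: (allP LA); apply: words_cons ak _.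
Qed.

(** * Letters of a random word *)

(* Scan the letters of a random word over k.+1 letters: the first one that is not k is
   uniform among the other k, and it exists except with probability (k + 1)^-n. *)
Lemma avg_cube_le_lines k n f (c : R) : (0 < k)%N -> 0 <= c -> (forall w, f w <= 1) ->
  (forall L, subspace k.+1 1 n L ->
     avg (iota 0 k) (fun a => f (fill k.+1 L [:: a])) <= c) ->
  avg (cube k.+1 n) f <= k.+1%:R^-1 ^+ n + c.
Proof.
move=> k0 c0; elim: n f => [|n IH] f f1 fc.
  by rewrite avg_words0 expr0; have := f1 [::]; lra.
rewrite avg_wordsS avg_iotaS // exprS; set q := k.+1%:R^-1.
have q0 : 0 <= q by rewrite invr_ge0.
have q1 : q <= 1 by rewrite invf_le1 // ler1n.
have top : avg (cube k.+1 n) (fun w => f (k :: w)) <= q ^+ n + c.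
  apply: IH => // L lineL.
  have kx : [:: k] \in cube k.+1 1 by apply: cube_cons.
  by have := fc _ (subspace_catl kx lineL); rewrite /= ltnSn.
have low : avg (iota 0 k) (fun a => avg (cube k.+1 n) (fun w => f (a :: w))) <= c.
  rewrite exchange_avg; apply: avg_le_cst => [|w kw]; first exact: cube_neq0.
  have := fc _ (subspace_catr kw (subspace_vars k.+1 1)); congr (_ <= _).
  by apply: eq_avg => a _; rewrite /= ltnn subnn (fill_id _ kw).
have : 0 <= 1 - q by lra.
by move=> /ler_wpM2l/(_ _ _ low); have := ler_wpM2l q0 top; lra.
Qed.

End Density.

Lemma exists_expr_le (R : archiRealFieldType) (x eps : R) :
  0 <= x < 1 -> 0 < eps -> exists n, x ^+ n <= eps.
Proof.
move=> /andP[x0 x1] eps0; have xnorm : `|x| < 1 by rewrite ger0_norm.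
have /cvgr0Pnorm_le /(_ _ eps0)[n _ /(_ n (leqnn n))] := cvg_expr xnorm.
by exists n; rewrite -[leLHS]ger0_norm ?exprn_ge0.
Qed.

Lemma avg_cube_le_subspaces (R : archiRealFieldType) k d (eps : R) :
  (0 < k)%N -> 0 < eps -> exists n,
  forall (f : seq nat -> R) c, 0 <= c -> (forall w, f w <= 1) ->
    (forall U, subspace k.+1 d n U -> avg (cube k d) (fun z => f (fill k.+1 U z)) <= c) ->
    avg (cube k.+1 n) f <= eps + c.
Proof.
move=> k0; elim: d eps => [|d IH] eps eps0.
  exists 0%N => f c c0 f1 fc; have := fc [::] isT; rewrite !avg_words0.
  by lra.
have eps2 : 0 < eps / 2 by lra.
have [n IHn] := IH _ eps2.
have [m qm] : exists m, k.+1%:R^-1 ^+ m <= eps / 2.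
  by apply: exists_expr_le => //; rewrite invr_ge0 ler0n invf_lt1 ?ltr1n ?ltnS.
exists (m + n)%N => f c c0 f1 fc; rewrite avg_words_cat.
pose g x := avg (cube k.+1 n) (fun y => f (x ++ y)).
suff : avg (cube k.+1 m) g <= k.+1%:R^-1 ^+ m + (eps / 2 + c) by move: qm; lra.
apply: avg_cube_le_lines => // [|x|L lineL]; first by lra.
  by apply: avg_le_cst => [|y _]; rewrite ?cube_neq0.
rewrite exchange_avg; apply: IHn => // [y|U subU].
  by apply: avg_le_cst; first exact: iota_neq0.
have := fc _ (subspace_cat lineL subU); rewrite avg_wordsS -exchange_avg; congr (_ <= _).
apply: eq_avg => a _; apply: eq_avg => z _.
by rewrite -cat1s (fill_cat_shift _ _ (subspace_cube lineL)).
Qed.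

(** * Insensitive sets *)

Lemma insensitive_contains_subspace (R : archiRealFieldType) k j d (eps : R) :
  (j < k)%N -> dhj R k -> 0 < eps ->
  exists n, forall E, insensitive k j n E -> eps <= density (cube k.+1 n) E ->
    contains_subspace k.+1 d n E.
Proof.
move=> jk dhjk eps0; have k0 : (0 < k)%N by lia.
have eps2 : 0 < eps / 2 by lra.
have eps3 : 0 < eps / 3 by lra.
have [m sub_m] := dhjk d _ eps2.
have [n avg_n] := avg_cube_le_subspaces m k0 eps3.
exists n => E insE E_dense.
have [P subP PE] : exists2 P, subspace k.+1 m n P &
    eps / 2 <= density (cube k m) (fun z => E (fill k.+1 P z)).
  apply: contrapT => no_P.
  suff : density (cube k.+1 n) E <= eps / 3 + eps / 2 by move: E_dense; lra.
  apply: avg_n => [|w|P subP]; [exact: ltW|by rewrite lern1 leq_b1|].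
  by rewrite leNgt; apply/negP => /ltW PE; apply: no_P; exists P.
have [V subV VE] := sub_m (fun z => E (fill k.+1 P z)) PE.
have subV1 := subspace_widen 1 subV.
apply: (contains_subspace_comp subP); exists (shift k 1 V) => //; apply/allP => z kz.
have insV := insensitive_fill jk (insensitive_fill jk insE (subspace_cube subP)).
rewrite (insV _ _ (subspace_cube subV1) _ kz) (fill_shift_widen k 1).
by apply: (allP VE); apply: relabel_in_cube.
Qed.

(* The section at x of E without the product of the subspace V with the set of those y
   for which V lies in the section of E at y. *)
Definition residue (k d : nat) V (E : pred (seq nat)) (x y : seq nat) : bool :=
  E (x ++ y) &&
  ~~ ((x \in map (fill k V) (cube k d)) && lies_in k d V (fun x => E (x ++ y))).

Lemma avg_residue (R : realFieldType) k d m n V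
    (E : pred (seq nat)) (f : seq nat -> R) :
  (0 < k)%N -> subspace k d m V ->
  avg (cube k (m + n)) (fun w => (E w)%:R * f w) =
    avg (cube k m) (fun x =>
      avg (cube k n) (fun y => (residue k d V E x y)%:R * f (x ++ y)))
    + (k ^ d)%:R / (k ^ m)%:R * avg (cube k n) (fun y =>
        (lies_in k d V (fun x => E (x ++ y)))%:R *
        avg (cube k d) (fun z => f (fill k V z ++ y))).
Proof.
move=> k0 subV; rewrite avg_words_cat.
pose V_points := [seq fill k V z | z <- cube k d].
pose VE y := lies_in k d V (fun x => E (x ++ y)).
have splitE x y : (E (x ++ y))%:R =
    (residue k d V E x y)%:R + (x \in V_points)%:R * (VE y)%:R :> R.
  rewrite /residue -/(VE y); have [/mapP[z kz ->]|_] := boolP (x \in _); last first.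
    by rewrite andbT mul0r addr0.
  have [/allP/(_ z kz) -> /=|_] := boolP (VE y); first by rewrite mulr1 add0r.
  by rewrite andbT mulr0 addr0.
under eq_avg => x _.
  under eq_avg => y _ do rewrite splitE mulrDl.
  rewrite avgD; over.
rewrite avgD; congr (_ + _); rewrite exchange_avg -avgZ; apply: eq_avg => y _.
transitivity ((VE y)%:R * avg (cube k m) (fun x => (x \in V_points)%:R * f (x ++ y))).
  by rewrite -avgZ; apply: eq_avg => x _; rewrite -mulrA mulrCA.
rewrite (avg_image (fun x => f (x ++ y))) ?cube_uniq ?cube_neq0 //.
- by rewrite !size_cube mulrCA.
- by move=> z z' /cube_size sz /cube_size sz'; apply: (fill_inj subV).
- by move=> _ /mapP[z kz ->]; apply: (fill_in_cube _ (subspace_cube subV)).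
Qed.

Lemma density_residue (R : realFieldType) k d m n V (E : pred (seq nat)) :
  (0 < k)%N -> subspace k d m V ->
  density (cube k (m + n)) E =
    avg (cube k m) (fun x => density (cube k n) (residue k d V E x))
    + (k ^ d)%:R / (k ^ m)%:R *
      density (cube k n) (fun y => lies_in k d V (fun x => E (x ++ y))) :> R.
Proof.
move=> k0 subV; have := avg_residue n E (fun=> 1 : R) k0 subV.
have avg1 T (s : seq T) (P : pred T) : avg s (fun x => (P x)%:R * 1) = density s P :> R.
  by rewrite /density /avg; under eq_bigr do rewrite mulr1.
rewrite avg1 => ->; congr (_ + _ * _); first by apply: eq_avg => x _; rewrite avg1.
by apply: eq_avg => y _; rewrite avg_cst ?cube_neq0 // mulr1.
Qed.

Section InsensitiveAverage.
Variables (R : archiRealFieldType) (k j d : nat).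
Hypothesis jk : (j < k)%N.
Implicit Types (E : pred (seq nat)) (f : seq nat -> R).

Lemma insensitive_residue m n V E x : V \in cube (k.+1 + d) m -> x \in cube k.+1 m ->
  insensitive k j (m + n) E -> insensitive k j n (residue k.+1 d V E x).
Proof.
move=> kV kx insE y ky; congr (_ && ~~ (_ && _)); first exact: (insensitive_catl jk insE).
apply: eq_in_all => z kz; apply: (insensitive_catl jk insE _ ky).
exact: fill_in_cube _ kV kz.
Qed.

Definition contains_products (m : nat) (eps c : R) : Prop :=
  forall n E, insensitive k j (m + n) E -> eps <= density (cube k.+1 (m + n)) E ->
    exists2 V, subspace k.+1 d m V &
      c <= (k.+1 ^ d)%:R / (k.+1 ^ m)%:R *
        density (cube k.+1 n) (fun y => lies_in k.+1 d V (fun x => E (x ++ y))).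

(* Greedy partition: cut off m letters at a time, each time removing the product of a
   subspace with an insensitive set from E. *)
Lemma insensitive_avg_le_iter m (eps c : R) : 0 <= eps -> 0 <= c <= 1 ->
  contains_products m eps c -> forall s f E,
    (forall w, f w <= 1) -> insensitive k j (s * m) E ->
    subspace_avg_le k.+1 d (s * m) f 0 ->
    avg (cube k.+1 (s * m)) (fun w => (E w)%:R * f w)
      <= eps + (1 - c) ^+ s * density (cube k.+1 (s * m)) E.
Proof.
move=> eps0 /andP[c0 c1] products; have c1' : 0 <= 1 - c by lra.
elim=> [|s IH] f E f1 insE f0.
  by rewrite expr0 mul1r; apply: le_trans (avg_mul_pred_le _ _) _; rewrite ?lerDr.
have [small|large] := leP (density (cube k.+1 (s.+1 * m)) E) eps.
  apply: (@le_trans _ _ eps); last by rewrite lerDl mulr_ge0 ?exprn_ge0 ?density_ge0.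
  exact: le_trans (avg_mul_pred_le _ (fun w _ => f1 w)) small.
rewrite mulSn in f0 insE large *.
have [V subV Vc] := products _ _ insE (ltW large).
have density_E := density_residue R (s * m) E (ltn0Sn k) subV.
rewrite (avg_residue _ _ _ (ltn0Sn k) subV); set E' := residue k.+1 d V E in density_E *.
have avg_product : (k.+1 ^ d)%:R / (k.+1 ^ m)%:R * avg (cube k.+1 (s * m)) (fun y =>
    (lies_in k.+1 d V (fun x => E (x ++ y)))%:R *
      avg (cube k.+1 d) (fun z => f (fill k.+1 V z ++ y))) <= 0.
  rewrite mulr_ge0_le0 ?divr_ge0 //; apply: avg_le_cst; rewrite ?cube_neq0 // => y ky.
  by rewrite mulr_ge0_le0 //; apply: (subspace_avg_le_catr ky f0).
have avg_E' : avg (cube k.+1 m) (fun x =>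
      avg (cube k.+1 (s * m)) (fun y => (E' x y)%:R * f (x ++ y)))
    <= eps + (1 - c) ^+ s *
         avg (cube k.+1 m) (fun x => density (cube k.+1 (s * m)) (E' x)).
  rewrite -[X in X + _](avg_cst _ (cube_neq0 m (ltn0Sn k))) -avgZ -avgD.
  apply: le_avg => x kx; apply: (IH (fun y => f (x ++ y))) => //.
    exact: insensitive_residue (subspace_cube subV) kx insE.
  exact: subspace_avg_le_catl kx f0.
have density_E' : avg (cube k.+1 m) (fun x => density (cube k.+1 (s * m)) (E' x))
    <= (1 - c) * density (cube k.+1 (m + s * m)) E.
  have := ler_wpM2l c0 (density_le1 R (cube k.+1 (m + s * m)) E).
  by rewrite mulr1 mulrBl mul1r; lra.
have := ler_wpM2l (exprn_ge0 s c1') density_E'.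
by rewrite exprSr -mulrA; lra.
Qed.

Hypothesis dhjk : dhj R k.

Lemma exists_contains_products (eps : R) : 0 < eps ->
  exists m c, 0 < c <= 1 /\ contains_products m eps c.
Proof.
move=> eps0; have eps2 : 0 < eps / 2 by lra.
have [m sub_m] := insensitive_contains_subspace d jk dhjk eps2.
have expn_gt0R l i : 0 < (l.+1 ^ i)%:R :> R by rewrite ltr0n expn_gt0.
pose c : R := (k.+1 ^ d)%:R / (k.+1 ^ m)%:R * (eps / 2 / ((k.+1 + d) ^ m)%:R).
exists m, (Num.min 1 c); split.
  by rewrite lt_min ltr01 !mulr_gt0 ?invr_gt0 ?expn_gt0R //= ge_min lexx.
move=> n E insE; rewrite density_cat => E_dense.
have [y ky||V subV V_dense] := common_subspace (t := cube k.+1 n)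
  (B := fun y x => E (x ++ y)) (m := m) (d := d) (ltn0Sn k) (ltW eps2) eps2.
- exact: sub_m (insensitive_catr jk insE ky).
- by move: E_dense; congr (_ <= _); lra.
exists V => //; rewrite ge_min; apply/orP; right.
by rewrite ler_pM2l ?divr_gt0 ?expn_gt0R.
Qed.

Lemma insensitive_avg_le (eps : R) : 0 < eps -> exists n, forall f E,
  (forall w, f w <= 1) -> insensitive k j n E -> subspace_avg_le k.+1 d n f 0 ->
  avg (cube k.+1 n) (fun w => (E w)%:R * f w) <= eps.
Proof.
move=> eps0; have eps2 : 0 < eps / 2 by lra.
have [m [c [/andP[c0 c1] products]]] := exists_contains_products eps2.
have [s s_small] : exists s, (1 - c) ^+ s <= eps / 2.
  by apply: exists_expr_le => //; lra.
exists (s * m)%N => f E f1 insE f0.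
have c01 : 0 <= c <= 1 by rewrite ltW.
have := insensitive_avg_le_iter (ltW eps2) c01 products f1 insE f0.
have q0 : 0 <= (1 - c) ^+ s by rewrite exprn_ge0; lra.
by have := ler_wpM2l q0 (density_le1 R (cube k.+1 (s * m)) E); lra.
Qed.

End InsensitiveAverage.

Definition insensitive_inter_avg_le (R : realFieldType) (k i d n : nat) (eps : R) :=
  forall (f : seq nat -> R) (E : nat -> pred (seq nat)),
    (forall w, f w <= 1) -> (forall j, (j < i)%N -> insensitive k j n (E j)) ->
    subspace_avg_le k.+1 d n f 0 ->
    avg (cube k.+1 n) (fun w => (inter_below E i w)%:R * f w) <= eps.

Lemma exists_insensitive_inter_avg_le (R : archiRealFieldType) k i d (eps : R) :
  (i <= k)%N -> dhj R k -> 0 < eps -> exists n, insensitive_inter_avg_le k i d n eps.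
Proof.
move=> ik dhjk; elim: i ik eps => [|i IH] ik eps eps0.
  exists d => f E f1 _ f0; under eq_avg => w _ do rewrite mul1r.
  exact: le_trans (avg_le_subspace_avg f0) (ltW eps0).
have eps2 : 0 < eps / 2 by lra.
have [e inter_e] := IH (ltnW ik) _ eps2.
have [n avg_n] := insensitive_avg_le e ik dhjk eps2.
exists n => f E f1 insE f0.
have -> : avg (cube k.+1 n) (fun w => (inter_below E i.+1 w)%:R * f w)
    = avg (cube k.+1 n) (fun w => (E i w)%:R * ((inter_below E i w)%:R * f w - eps / 2))
      + eps / 2 * density (cube k.+1 n) (E i).
  by rewrite -avgZ -avgD; apply: eq_avg => w _; rewrite inter_belowS -mulnb natrM; ring.
have := ler_wpM2l (ltW eps2) (density_le1 R (cube k.+1 n) (E i)).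
suff : avg (cube k.+1 n) (fun w =>
    (E i w)%:R * ((inter_below E i w)%:R * f w - eps / 2)) <= eps / 2 by lra.
apply: avg_n => [w||U subU]; [|exact: insE|].
  by have := f1 w; case: (inter_below E i w); rewrite /= ?mul1r ?mul0r; lra.
rewrite avgB avg_cst ?cube_neq0 // subr_le0.
apply: (inter_e _ (fun j z => E j (fill k.+1 U z))) => // [j ji|].
  have jk : (j < k)%N := leq_trans ji (ltnW ik).
  exact: (insensitive_fill jk (insE j (ltnW ji)) (subspace_cube subU)).
exact: subspace_avg_le_fill subU f0.
Qed.

(** * Sets without lines *)

Section DensityBounds.
Variables (R : realFieldType) (k d : nat).
Implicit Types (A : pred (seq nat)) (D : nat -> pred (seq nat)) (c eps : R).

(* The complement of the intersection of the D_i is the disjoint union of the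
   intersections of D_0, .., D_(i - 1) and the complement of D_i. *)
Lemma density_le_avoid_inter n eps c A D : 0 <= c ->
  insensitive_inter_avg_le k k d n eps ->
  (forall i, (i < k)%N -> insensitive k i n (D i)) ->
  subspace_avg_le k.+1 d n (fun w => (A w)%:R) c ->
  {in cube k.+1 n, forall w, inter_below D k w -> ~~ A w} ->
  density (cube k.+1 n) A <=
    k%:R * eps + c - c * density (cube k.+1 n) (inter_below D k).
Proof.
move=> c0 inter_le insD A_le A_avoids; pose f w : R := (A w)%:R - c.
have f1 w : f w <= 1 by rewrite /f; case: (A w); rewrite /=; lra.
have f_le0 : subspace_avg_le k.+1 d n f 0.
  by move=> U subU; rewrite avgB avg_cst ?cube_neq0 // subr_le0; apply: A_le.
have avg_f_compl :
    avg (cube k.+1 n) (fun w => (~~ inter_below D k w)%:R * f w) <= k%:R * eps.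
  under eq_avg => w _ do rewrite natr_not_inter_below mulr_suml.
  rewrite -[k in k%:R * _](size_iota 0) mulr_natl -sumr_const_seq.
  rewrite avg_sum big_seq [leRHS]big_seq; apply: ler_sum => i.
  rewrite mem_iota add0n => /andP[_ ik].
  pose E j w := if (j < i)%N then D j w else (j == i) ==> ~~ D j w.
  under eq_avg => w _ do rewrite -(inter_below_first_failure D w ik).
  apply: (inter_le f E) => // j jk w kw.
  by rewrite /E (insD j jk w kw).
have : avg (cube k.+1 n) (fun w => (~~ inter_below D k w)%:R * f w)
    = density (cube k.+1 n) A - c
      + c * density (cube k.+1 n) (inter_below D k).
  rewrite -avgZ -[X in _ - X](avg_cst c (cube_neq0 n (ltn0Sn k))) -avgB -avgD.
  apply: eq_avg => w /A_avoids; rewrite /f; case: (inter_below _ _ _) => /=; last by lra.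
  by move=> /(_ isT)/negbTE -> /=; lra.
by move: avg_f_compl; lra.
Qed.

(* If the line w over k letters lies in the section of A at y, then its top point
   (w, y) is not in A. *)
Lemma line_free_density_le m e n (alpha theta eps : R) c A U : 0 <= c ->
  insensitive_inter_avg_le k k d e eps -> ~ contains_subspace k.+1 1 (m + n) A ->
  subspace_avg_le k.+1 d (m + n) (fun w => (A w)%:R) c ->
  {in cube k.+1 m, forall x, alpha <= density (cube k.+1 n) (fun y => A (x ++ y))} ->
  subspace k.+1 e m U -> k \in U ->
  theta <= avg (cube k.+1 e) (fun v => density (cube k.+1 n) (fun y =>
    lies_in k 1 (fill k.+1 U v) (fun x => A (x ++ y)))) ->
  alpha <= k%:R * eps + c - c * theta.
Proof.
move=> c0 inter_le A_free A_le alpha_le subU kU theta_le.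
have cubeU := subspace_cube subU.
have fillU v : v \in cube k.+1 e -> fill k.+1 U v \in cube k.+1 m.
  exact: fill_in_cube cubeU.
pose AU y v := A (fill k.+1 U v ++ y).
pose lines y v := lies_in k 1 (fill k.+1 U v) (fun x => A (x ++ y)).
have AU_le y : y \in cube k.+1 n ->
    density (cube k.+1 e) (AU y) <= k%:R * eps + c - c * density (cube k.+1 e) (lines y).
  move=> ky; pose D i v := A (relabel k i (fill k.+1 U v) ++ y).
  have -> : lines y = inter_below D k.
    by apply/funext => v; rewrite /lines lies_in_line.
  apply: (density_le_avoid_inter c0 inter_le).
  - by move=> i ik; apply: (insensitive_relabel ik (fun x => A (x ++ y)) cubeU).
  - exact: subspace_avg_le_fill subU (subspace_avg_le_catr ky A_le).
  - move=> v kv line_v; apply/negP => Av; apply: A_free.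
    apply: (contains_subspace_catr ky); apply: (contains_line_top (fillU v kv) _ _ Av).
      by apply/mapP; exists k => //; rewrite ltnSn.
    by rewrite lies_in_line.
rewrite exchange_avg in theta_le.
have : alpha <= avg (cube k.+1 n) (fun y => density (cube k.+1 e) (AU y)).
  by rewrite exchange_avg; apply: avg_ge_cst => [|v /fillU/alpha_le]; rewrite ?cube_neq0.
have := le_avg AU_le; rewrite avgB avg_cst ?cube_neq0 // avgZ.
by have := ler_wpM2l c0 theta_le; lra.
Qed.

End DensityBounds.

Lemma line_free_section_ge (R : realFieldType) k m n (u l : R) A :
  forces k 1 n u -> ~ contains_subspace k 1 (m + n) A ->
  l <= density (cube k (m + n)) A ->
  {in cube k m, forall x,
    u - (k ^ m)%:R * (u - l) <= density (cube k n) (fun y => A (x ++ y))}.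
Proof.
move=> forces_u A_free A_dense x kx; rewrite -size_cube.
pose f x := density (cube k n) (fun y => A (x ++ y)) : R.
apply: (avg_near_max (f := f)) kx => [z kz|].
  apply: avg_le_subspace_avg; apply: (subspace_avg_le_catl (f := fun w => (A w)%:R) kz).
  exact: forces_density_le forces_u A_free.
by rewrite /density avg_words_cat in A_dense.
Qed.

(** * Subspaces of lines *)

(* The i-th block of this subspace over k letters is k :: v_i with the letter k turned
   into the i-th variable, where v_i is the i-th word of vs. When the i-th variable is
   filled with k again, the block is k :: v_i for an arbitrary word v_i. *)
Definition blocks (k : nat) (vs : seq (seq nat)) : seq nat :=
  foldr (fun v U => (k :: v) ++ shift k 1 U) [::] vs.

Lemma block_in_cube k n v : v \in cube k.+1 n -> k :: v \in cube (k + 1) n.+1.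
Proof. by move=> kv; rewrite addn1; apply: cube_cons. Qed.

Lemma subspace_blocks k m n vs :
  vs \in words (cube k.+1 n) m -> subspace k m (m * n.+1) (blocks k vs).
Proof.
elim: m vs => [|m IH] vs; first by rewrite inE => /eqP ->.
move=> /words_consP[v [vs' [-> kv /IH sub_vs]]].
have : subspace k 1 n.+1 (k :: v).
  apply/subspaceP; split; first exact: block_in_cube.
  by case=> // _; rewrite addn0 mem_head.
by move=> /subspace_cat/(_ sub_vs).
Qed.

Lemma fill_blocks_cons k n v vs a z : v \in cube k.+1 n ->
  fill k (blocks k (v :: vs)) (a :: z) = relabel k a (k :: v) ++ fill k (blocks k vs) z.
Proof. by move=> /block_in_cube kv; apply: (fill_cat_shift (x := [:: a]) _ _ kv). Qed.

Section SubspaceOfLines.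
Variables (R : realFieldType) (k n : nat).

Lemma exists_block_subspace m (f : seq nat -> R) (c : R) L :
  L \in cube k.+1 m -> k \in L ->
  c <= avg (words (cube k.+1 n) m) (fun vs => f (fill k (blocks k vs) L)) ->
  exists U, [/\ subspace k.+1 n (m * n.+1) U, k \in U &
    c <= avg (cube k.+1 n) (fun v => f (fill k.+1 U v))].
Proof.
elim: m f L => [|m IH] f L; first by rewrite inE => /eqP ->.
move=> /words_consP[a [L' [-> ak kL']]]; rewrite mem_iota ltnS in ak.
pose g v vs := f (relabel k a (k :: v) ++ fill k (blocks k vs) L').
have fill_cons v vs : v \in cube k.+1 n ->
    f (fill k (blocks k (v :: vs)) (a :: L')) = g v vs.
  by rewrite /g => /fill_blocks_cons ->.
rewrite avg_wordsS inE eq_sym.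
under eq_avg => v kv do under eq_avg do rewrite fill_cons //.
have cube0 : cube k.+1 n != [::] by apply: cube_neq0.
have [a_k|a_neq_k] /= := eqVneq a k => [_|kL'_k].
  rewrite exchange_avg => /le_trans le_c.
  have [vs /subspace_blocks sub_vs /le_c{le_c} c_le] :=
    exists_avg_le (fun vs => avg (cube k.+1 n) (g^~ vs)) (words_neq0 m cube0).
  have ky : fill k (blocks k vs) L' \in cube k.+1 (m * n.+1).
    exact: fill_in_cube (subspace_cube sub_vs) kL'.
  exists ((k :: iota k.+1 n) ++ fill k (blocks k vs) L'); split; [|exact: mem_head|].
    rewrite mulSn; apply: (subspace_catr ky).
    by apply: (@subspace_catl _ n 1 n [:: k]); rewrite ?cube_cons ?subspace_vars.
  move: c_le; congr (_ <= _); apply: eq_avg => v kv.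
  rewrite /g a_k (@relabel_self k n.+1) ?cube_cons // fill_cat (fill_id _ ky) /= ltnSn.
  by rewrite fill_vars // (cube_size kv).
have {}ak : (a < k)%N by rewrite ltn_neqAle a_neq_k.
move=> /le_trans le_c; have [v kv /le_c{le_c}] :=
  exists_avg_le (fun v => avg (words (cube k.+1 n) m) (g v)) cube0.
have kx : relabel k a (k :: v) \in cube k.+1 n.+1.
  by apply: (relabel_in_cubeS ak); apply: cube_cons.
move=> /(IH (fun y => f (relabel k a (k :: v) ++ y)) _ kL' kL'_k)[U [subU kU c_le]].
exists (relabel k a (k :: v) ++ U); split; [|by rewrite mem_cat kU orbT|].
  by rewrite mulSn; apply: subspace_catl.
by move: c_le; congr (_ <= _); apply: eq_avg => z _; rewrite fill_cat (fill_id _ kx).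
Qed.

Lemma exists_subspace_of_lines m e (a b : R) A : (0 < k)%N -> 0 <= a -> 0 < b ->
  forces k 1 m a ->
  {in cube k.+1 (m * n.+1), forall x,
    a + b <= density (cube k.+1 e) (fun y => A (x ++ y))} ->
  exists U, [/\ subspace k.+1 n (m * n.+1) U, k \in U &
    b / (k.+1 ^ m)%:R <= avg (cube k.+1 n) (fun v => density (cube k.+1 e) (fun y =>
      lies_in k 1 (fill k.+1 U v) (fun x => A (x ++ y))))].
Proof.
move=> k0 a0 b0 forces_a A_dense.
pose t := [seq (vs, y) | vs <- words (cube k.+1 n) m, y <- cube k.+1 e].
have [p _||L lineL] := common_subspace (t := t) (d := 1) (m := m)
  (B := fun p u => A (fill k (blocks k p.1) u ++ p.2)) k0 a0 b0.
- exact: forces_a.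
- rewrite avg_allpairs; apply: avg_ge_cst => [|vs /subspace_blocks/subspace_cube cube_vs].
    by rewrite words_neq0 ?cube_neq0.
  rewrite exchange_avg; apply: avg_ge_cst => [|u ku]; first exact: cube_neq0.
  by apply: A_dense; apply: fill_in_cube cube_vs _; rewrite // (sub_cube (leqnSn k)).
rewrite /density avg_allpairs addn1 => L_dense.
have kL : L \in cube k.+1 m by rewrite -addn1 subspace_cube.
pose f w := density (cube k.+1 e) (fun y => lies_in k 1 w (fun x => A (x ++ y))) : R.
apply: (exists_block_subspace (f := f) kL).
  by case/subspaceP: lineL => _ /(_ 0%N isT); rewrite addn0.
move: L_dense; congr (_ <= _); apply: eq_avg => vs /subspace_blocks/subspace_cube cube_vs.
apply: eq_avg => y _; rewrite (lies_in_comp _ (fun x => A (x ++ y)) _ cube_vs) //.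
exact: cube_size kL.
Qed.

End SubspaceOfLines.

(** * The density Hales-Jewett theorem *)

Lemma forces_le (R : realFieldType) k d n (a b : R) :
  a <= b -> forces k d n a -> forces k d n b.
Proof. by move=> ab forces_a A /(le_trans ab); apply: forces_a. Qed.

(* With c = delta + beta, the lower bound delta - beta for the sections of a line-free
   set contradicts line_free_density_le, as c theta > 3 beta. *)
Lemma forces_lower (R : archiRealFieldType) k (delta : R) :
  (0 < k)%N -> 0 < delta -> dhj R k ->
  (forall delta', delta < delta' -> exists n, forces k.+1 1 n delta') ->
  exists delta', delta' < delta /\ exists n, forces k.+1 1 n delta'.
Proof.
move=> k0 delta0 dhjk above.
have delta2 : 0 < delta / 2 by lra.
have [m0 forces_m0] := dhjk 1%N _ delta2.
pose theta := delta / 4 / (k.+1 ^ m0)%:R.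
have theta0 : 0 < theta by rewrite !divr_gt0 ?ltr0n ?expn_gt0.
pose beta := Num.min (delta / 4) (delta * theta / 4).
have beta0 : 0 < beta by rewrite lt_min !divr_gt0 ?mulr_gt0.
have beta_le : beta <= delta / 4 by rewrite ge_min lexx.
have beta_theta : 4 * beta <= delta * theta.
  by rewrite -ler_pdivlMl // mulrC ge_min lexx orbT.
have above_add x : 0 < x -> exists n, forces k.+1 1 n (delta + x).
  by move=> x0; apply: above; rewrite ltrDl.
have [d forces_d] := above_add _ beta0.
have kR0 : 0 < k%:R :> R by rewrite ltr0n.
have [n inter_n] := exists_insensitive_inter_avg_le d (leqnn k) dhjk (divr_gt0 beta0 kR0).
pose m := (m0 * n.+1)%N.
have km0 : 0 < (k.+1 ^ m)%:R :> R by rewrite ltr0n expn_gt0.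
pose gamma := beta / (2 * (k.+1 ^ m)%:R).
have gamma0 : 0 < gamma by rewrite divr_gt0 ?mulr_gt0.
have gammaE : (k.+1 ^ m)%:R * (2 * gamma) = beta.
  by rewrite /gamma; field; rewrite gt_eqF.
have [e forces_e] := above_add _ gamma0.
exists (delta - gamma); split; first by lra.
exists (m + e)%N => A A_dense; apply: contrapT => A_free.
have section_ge : {in cube k.+1 m, forall x,
    delta - beta <= density (cube k.+1 e) (fun y => A (x ++ y))}.
  move=> x kx; apply: le_trans (line_free_section_ge forces_e A_free A_dense kx).
  by rewrite (_ : _ - (delta - gamma) = 2 * gamma) ?gammaE; lra.
have delta4 : 0 < delta / 4 by lra.
have [x kx|U [subU kU U_theta]] :=
    exists_subspace_of_lines (n := n) (A := A) (e := e) k0 (ltW delta2) delta4 forces_m0.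
  by apply: le_trans (section_ge x kx); lra.
have c0 : 0 <= delta + beta by lra.
have := line_free_density_le c0 inter_n A_free (forces_density_le forces_d A_free)
  section_ge subU kU U_theta.
rewrite mulrCA divff ?gt_eqF // mulr1 -/theta.
by have : 0 < beta * theta := mulr_gt0 beta0 theta0; lra.
Qed.

Lemma forces_one_letter (R : realFieldType) (delta : R) : 0 < delta -> forces 1 1 1 delta.
Proof.
move=> delta0 A /(lt_le_trans delta0)/density_gt0_exists[w].
rewrite inE => /eqP -> A0; exists [:: 1%N] => //.
by rewrite /lies_in /= A0.
Qed.

Theorem density_hales_jewett (R : realType) k : dhj R k.+1.
Proof.
elim: k => [|k IH]; apply: dhj_of_lines => // delta delta0.
  by exists 1%N; apply: forces_one_letter.
pose S : set R := [set x | 0 < x /\ exists n, forces k.+2 1 n x]%classic.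
have S2 : S 2.
  split=> //; exists 0%N => A /le_trans/(_ (density_le1 R _ A)); lra.
have S_inf : has_inf S by split; [exists 2|exists 0 => x [/ltW]].
have above x : inf S < x -> exists n, forces k.+2 1 n x.
  move=> /(inf_lt S_inf.1)[y [_ [n forces_y]] /ltW yx].
  by exists n; apply: forces_le forces_y.
apply: (above); rewrite ltNge; apply/negP => delta_le.
have inf0 := lt_le_trans delta0 delta_le.
have [x [x_lt [n forces_x]]] := forces_lower (ltn0Sn k) inf0 IH above.
have : inf S <= Num.max x (inf S / 2).
  apply: (ge_inf S_inf.2); split; first by rewrite lt_max divr_gt0 ?orbT.
  by exists n; apply: forces_le forces_x; rewrite le_max lexx.
by rewrite le_max => /orP[]; lra.
Qed.

(** * Progressions in almost invariant sets *)

Lemma sumn_relabel k i U : U \in cube (k + 1) (size U) ->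
  sumn (relabel k i U) = (i * count_mem k U + sumn (relabel k 0 U))%N.
Proof.
case/cubeP => _; elim: U => [|c U IH] kU; first by rewrite muln0.
rewrite /= -!/(fill _ _ _) -!/(relabel _ _ _) IH; last first.
  by move=> e eU; apply: kU; rewrite inE eU orbT.
have := kU c (mem_head _ _); case: (ltngtP c k) => [ck|kc|->] ck1.
- by rewrite add0n addnCA.
- by lia.
- by rewrite subnn /= mulnDr muln1 add0n addnA.
Qed.

Lemma sumn_le k n w : w \in cube k n -> (sumn w <= n * k)%N.
Proof.
case/cubeP=> <-; elim: w => //= a w IH kw; rewrite mulSn leq_add //.
  by apply: ltnW; apply: kw; rewrite mem_head.
by apply: IH => b bw; apply: kw; rewrite inE bw orbT.
Qed.

Lemma limn_sup_gt_frequently (R : realType) (u : nat -> R) x :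
  bounded_fun u -> x < limn_sup u -> forall n, exists2 m, (n <= m)%N & x < u m.
Proof.
move=> bu; rewrite limn_supE // => x_lt n.
have sdrop0 : sdrop u n !=set0 by exists (u n), n => /=.
have inf_le : inf (range (sups u)) <= sups u n.
  by apply: ge_inf; [exact: bounded_fun_has_lbound_sups|exists n].
have [_ [m nm <-] xum] := sup_gt sdrop0 (lt_le_trans x_lt inf_le).
by exists m.
Qed.

Lemma iter_mulgr (G : groupType) n (b a : G) :
  iter n (fun x => x * b)%g a = (a * b ^+ n)%g.
Proof. by elim: n => [|n IH]; rewrite ?mulg1 //= IH expgSr mulgA. Qed.

Section Iteration.
Variables (R : realType) (G : groupType).
Implicit Types (T : G -> G) (F : {fset G}) (P L : pred G).

Lemma dens_ratioE P F : dens_ratio R P F = density F P.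
Proof.
rewrite /dens_ratio /density /avg card_fset_sum1 natr_sum -big_fset_condE big_mkcond.
by congr (_ / _); apply: eq_bigr => a _; case: (P a).
Qed.

Lemma dens_ratio_ge0_le1 P F : 0 <= dens_ratio R P F <= 1.
Proof. by rewrite dens_ratioE density_ge0 density_le1. Qed.

Lemma dens_ratio_preim T F P :
  dens_ratio R P F <= dens_ratio R (P \o T) F + sd_ratio R [fset T x | x in F]%fset F.
Proof.
rewrite /dens_ratio /sd_ratio -mulrDl -natrD ler_wpM2r ?invr_ge0 // ler_nat.
apply: (@leq_trans #|` ([fset T x | x in [fset x in F | P (T x)]]
    `|` fsymdiff [fset T x | x in F] F)%fset|); last first.
  rewrite cardfsU; apply: leq_trans (leq_subr _ _) _.
  by rewrite leq_add2r leq_imfset_card.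
apply: fsubset_leq_card; apply/fsubsetP => x; rewrite !inE /= => /andP[xF Px].
case: (boolP (x \in [fset T x | x in F]%fset)) => xT /=; last by rewrite xF !orbT.
apply/orP; left; case/imfsetP: xT => y /= yF xE; apply/imfsetP; exists y => //=.
by rewrite !inE yF /= -xE.
Qed.

Lemma dens_ratio_iter T F P s :
  dens_ratio R P F <= dens_ratio R (fun x => P (iter s T x)) F
    + s%:R * sd_ratio R [fset T x | x in F]%fset F.
Proof.
elim: s => [|s IH]; first by rewrite mul0r addr0.
have := dens_ratio_preim T F (fun x => P (iter s T x)).
have -> : (fun x => P (iter s T x)) \o T = fun x => P (iter s.+1 T x).
  by apply/funext => x; rewrite iterSr.
by move: IH; rewrite -natr1; lra.
Qed.

Lemma iter_progression_of_almost_invariant k (delta : R) : 0 < delta ->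
  exists2 eps : R, 0 < eps & forall T F L, F != fset0%fset ->
    delta <= dens_ratio R L F -> sd_ratio R [fset T x | x in F]%fset F <= eps ->
    exists n a, (0 < n)%N /\ forall j, (j < k.+1)%N -> L (iter (j * n) T a).
Proof.
move=> delta0; have delta2 : 0 < delta / 2 by lra.
have [N forces_N] := @density_hales_jewett R k 1 _ delta2.
pose c : R := (N * k.+1)%:R + 1; have c0 : 0 < c by rewrite ltr_wpDl.
exists (delta / 2 / c) => [|T F L F0 L_dense F_inv]; first by rewrite divr_gt0.
have F_neq0 : enum_fset F != [::] by rewrite -size_eq0 cardfs_eq0.
have iter_dense w : w \in cube k.+1 N ->
    delta / 2 <= density F (fun a => L (iter (sumn w) T a)).
  move=> /sumn_le sumn_w; rewrite -dens_ratioE.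
  have := dens_ratio_iter T F L (sumn w).
  suff : (sumn w)%:R * sd_ratio R [fset T x | x in F]%fset F <= delta / 2 by lra.
  have -> : delta / 2 = c * (delta / 2 / c) by rewrite mulrCA divff ?gt_eqF // mulr1.
  apply: ler_pM => //; first by rewrite divr_ge0.
  by rewrite ler_wpDr // ler_nat.
have := avg_ge_cst (cube_neq0 N (ltn0Sn k)) iter_dense; rewrite exchange_avg => avg_dense.
have [a _ a_dense] := exists_avg_le (fun a => density (cube k.+1 N)
  (fun w => L (iter (sumn w) T a)) : R) F_neq0.
have [U /subspaceP[cubeU /(_ 0%N isT) kU]] :=
  forces_N (fun w => L (iter (sumn w) T a)) (le_trans avg_dense a_dense).
rewrite addn0 in kU; rewrite lies_in_line => /allP lineU.
exists (count_mem k.+1 U), (iter (sumn (relabel k.+1 0 U)) T a); split.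
  by rewrite -has_count has_pred1.
move=> j jk; rewrite -iterD -sumn_relabel; first by apply: lineU; rewrite mem_iota.
by rewrite (cube_size cubeU).
Qed.

Lemma iter_progression T (F : nat -> {fset G}) L :
  (forall n, F n != fset0%fset) -> 0 < limn_sup (fun n => dens_ratio R L (F n)) ->
  (fun n => sd_ratio R [fset T x | x in F n]%fset (F n)) @ \oo --> (0 : R) ->
  forall k, (0 < k)%N -> exists n a, (0 < n)%N /\
    forall j, (j < k)%N -> L (iter (j * n) T a).
Proof.
move=> F0 L_dense F_inv [//|k] _.
have bounded_dens : bounded_fun (fun n => dens_ratio R L (F n)).
  exists 1; split=> // M M1 n _ /=; have /andP[ge0 le1] := dens_ratio_ge0_le1 L (F n).
  by rewrite ger0_norm // (le_trans le1 (ltW M1)).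
have [delta delta0 delta_lt] : exists2 delta,
    0 < delta & delta < limn_sup (fun n => dens_ratio R L (F n)).
  by exists (limn_sup (fun n => dens_ratio R L (F n)) / 2); lra.
have [eps eps0 progression] := iter_progression_of_almost_invariant k delta0.
have /cvgr0Pnorm_le /(_ _ eps0)[m _ sd_le] := F_inv.
have [n mn dens_gt] := limn_sup_gt_frequently bounded_dens delta_lt m.
apply: (progression T (F n)); [exact: F0|exact: ltW dens_gt|].
exact: le_trans (ler_norm _) (sd_le n mn).
Qed.

End Iteration.

Theorem mainTheorem1 (R : realType) (G : groupType) (F : nat -> {fset G})
    (b : G) (L : pred G)
    (hF : forall n, F n != fset0)
    (hL : (0 < limn_sup (fun n => dens_ratio R L (F n)))%R) :
  ((fun n => sd_ratio R (ltrans b (F n)) (F n)) @ \oo --> (0 : R)%R ->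
     forall k : nat, (0 < k)%N ->
       exists (n : nat) (a : G), (0 < n)%N /\
         forall j : nat, (j < k)%N -> L ((b ^+ (j * n)) * a)%g)
  /\
  ((fun n => sd_ratio R (rtrans b (F n)) (F n)) @ \oo --> (0 : R)%R ->
     forall k : nat, (0 < k)%N ->
       exists (n : nat) (a : G), (0 < n)%N /\
         forall j : nat, (j < k)%N -> L (a * (b ^+ (j * n)))%g).
Proof.
split=> b_fixes k k0.
  have [n [a [n0 progression]]] :=
    iter_progression (T := fun x => (b * x)%g) hF hL b_fixes k0.
  by exists n, a; split=> // j /progression; rewrite iter_mulg.
have [n [a [n0 progression]]] :=
  iter_progression (T := fun x => (x * b)%g) hF hL b_fixes k0.
by exists n, a; split=> // j /progression; rewrite iter_mulgr.
Qed.
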